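(* Let $F\subset\mathbb{R}^d$ be a compact convex set with $0\in\operatorname{int}(F)$, let $m\ge 2$, $1\le k\le m$, and let $\Omega^1,\dots,\Omega^m\subset\mathbb{R}^d$ be nonempty compact sets. Then the set $S_k$ of global minimizers over $\mathbb{R}^{dk}$ of $f_k(x^1,\dots,x^k)=\sum_{i=1}^m\min_{1\le j\le k}T_F(x^j,\Omega^i)$ is nonempty and closed.
   Context: $\mathbb{R}^d$ ($d\ge1$) carries the Euclidean norm. For a nonempty set $\Omega\subset\mathbb{R}^d$ the minimal time function is $T_F(x,\Omega)=\inf\{t\ge 0\mid (x+tF)\cap\Omega\neq\emptyset\}$, $x\in\mathbb{R}^d$. Elements of $\mathbb{R}^{dk}=(\mathbb{R}^d)^k$ are written $x=(x^1,\dots,x^k)$ with $x^j\in\mathbb{R}^d$. $S_k=\{y\in\mathbb{R}^{dk}\mid f_k(y)=\min_{x\in\mathbb{R}^{dk}}f_k(x)\}$, i.e. $S_k=\{y \mid f_k(y)\le f_k(x)\ \text{for all } x\in\mathbb{R}^{dk}\}$. *)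

(* Defs.v *)
From HB Require Import structures.
From mathcomp Require Import all_boot all_order all_algebra.
From mathcomp Require Import all_classical all_reals all_analysis.

Set Implicit Arguments.
Unset Strict Implicit.
Unset Printing Implicit Defensive.

Import Order.TTheory GRing.Theory Num.Theory.
Import numFieldNormedType.Exports.

Local Open Scope classical_set_scope.
Local Open Scope ring_scope.

(* The canonical norm on 'rV[R]_d and 'M[R]_(k, d) is the max norm. Only the
   induced topology matters here, and it is the Euclidean one. *)

(* The infimum is taken in \bar R, with value +oo on the empty set. It is a
   real number as soon as 0 is interior to F and Omega is nonempty. *)
Definition min_time (R : realType) (d : nat) (F : set 'rV[R]_d)
    (x : 'rV[R]_d) (Omega : set 'rV[R]_d) : \bar R :=
  ereal_inf [set t%:E | t in [set t : R |
    0 <= t /\ [set x + t *: v | v in F] `&` Omega !=set0]].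

(* A point (x^1, ..., x^k) of (R^d)^k is the k x d matrix with rows x^j; +oo is
   the neutral element of the minimum. *)
Definition multifacility_cost (R : realType) (d m : nat) (F : set 'rV[R]_d)
    (Omega : 'I_m -> set 'rV[R]_d) (k : nat) (x : 'M[R]_(k, d)) : \bar R :=
  (\sum_(i < m) \big[Order.min/+oo]_(j < k) min_time F (row j x) (Omega i))%E.

Definition global_minimizers (R : realType) (T : Type) (f : T -> \bar R) :
    set T :=
  [set y | forall x, (f y <= f x)%E].

(* Main.v *)
Require Import Defs.
From HB Require Import structures.
From mathcomp Require Import all_boot all_order all_algebra.
From mathcomp Require Import all_classical all_reals all_analysis.
From mathcomp Require Import lra.

Set Implicit Arguments.
Unset Strict Implicit.

Import Order.TTheory GRing.Theory Num.Theory.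
Import numFieldNormedType.Exports.

Local Open Scope classical_set_scope.
Local Open Scope ring_scope.

(* If F contains the ball of radius r around 0 and lies in the ball of radius M,
   then T_F(., Omega) is (1/r)-Lipschitz by convexity of F, and it grows at least
   like |x| / M. Hence the cost is finite and Lipschitz, which makes S closed.
   Moving to the origin every facility that is farther than some fixed rho does
   not increase the cost, so the minimum over the compact ball of radius rho is
   global. *)

(** * Lipschitz maps, the max norm on matrices, convex combinations *)

Lemma continuous_of_lipschitz (R : realType) (V W : normedModType R) (f : V -> W)
    (C : R) :
  (forall x y, `|f x - f y| <= C * `|x - y|) -> continuous f.
Proof.
move=> fL x; apply/cvgrPdist_le => e e0.
(* The sign of [C] is unknown; [|C| + 1] is a positive Lipschitz constant by which [e] can be
   divided. *)
have C0 : 0 < `|C| + 1 by rewrite ltr_pwDr.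
near=> y.
apply: (le_trans (fL x y)).
apply: (@le_trans _ _ ((`|C| + 1) * `|x - y|)).
  by rewrite ler_wpM2r// (le_trans (ler_norm C))// lerDl.
rewrite mulrC -ler_pdivlMr//.
near: y; apply: (@cvgr_dist_le _ _ _ (nbhs x) _ id x cvg_id).
exact: divr_gt0.
Unshelve. all: by end_near. Qed.

Lemma mx_entry_norm_le (R : realType) (m n : nat) (x : 'M[R]_(m, n)) i j : `|x i j| <= `|x|.
Proof.
rewrite [leRHS]/Num.norm /= mx_normrE.
by apply/bigmax_geP; right => /=; exists (i, j).
Qed.

Lemma mx_norm_le (R : realType) (m n : nat) (x : 'M[R]_(m, n)) (c : R) :
  0 <= c -> (forall i j, `|x i j| <= c) -> `|x| <= c.
Proof.
move=> c0 xc; rewrite [leLHS]/Num.norm /= mx_normrE.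
by apply/bigmax_leP; split=> // -[i j] _; exact: xc.
Qed.

Lemma row_norm_le (R : realType) (m n : nat) (x : 'M[R]_(m, n)) i : `|row i x| <= `|x|.
Proof.
by apply: mx_norm_le => // ? j; rewrite mxE; exact: mx_entry_norm_le.
Qed.

(** For the max norm the ball is a cube: the image under the 1-Lipschitz map [vec_mx] of a product
    of segments, compact by Tychonoff. *)
Lemma mx_ball_compact (R : realType) (m n : nat) (rho : R) :
  compact [set x : 'M[R]_(m, n) | `|x| <= rho].
Proof.
have [rho0|rho0] := ltP rho 0.
  rewrite (_ : [set _ | _] = set0); first exact: compact0.
  apply/seteqP; split => x //= xrho.
  by have := le_lt_trans xrho rho0; rewrite normr_lt0.
pose K := [set v : 'rV[R]_(m * n) | forall i, `[- rho, rho]%classic (v ord0 i)].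
rewrite (_ : [set _ | _] = vec_mx @` K).
  apply: continuous_compact; last first.
    apply: (@rV_compact _ _ (fun=> `[- rho, rho]%classic)) => _.
    exact: segment_compact.
  apply: continuous_subspaceT; apply: (@continuous_of_lipschitz _ _ _ _ 1) => u v.
  rewrite mul1r -linearB; apply: mx_norm_le => // i j.
  by rewrite mxE; exact: mx_entry_norm_le.
apply/seteqP; split => [x /= xrho|_ [v Kv <-] /=].
  exists (mxvec x); last exact: mxvecK.
  move=> l; case/mxvec_indexP: l => i j.
  rewrite mxvecE /= in_itv /= -ler_norml.
  exact: le_trans (mx_entry_norm_le _ _ _) xrho.
apply: mx_norm_le => // i j; rewrite mxE ler_norml.
by have := Kv (mxvec_index i j); rewrite /= in_itv.
Qed.

(** Dividing by [s + t] leaves a convex combination. In this form, moving for time [s] along [u] and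
    then for time [t] along [v] becomes a single motion of duration [s + t]. *)
Lemma convex_set_combination (R : realType) (V : lmodType R) (F : set V)
    (u v : V) (s t : R) :
  convex_set F -> F u -> F v -> 0 <= s -> 0 <= t -> 0 < s + t ->
  exists2 w, F w & (s + t) *: w = s *: u + t *: v.
Proof.
move=> Fconv Fu Fv s0 t0 st0.
have st1 : 0 <= s / (s + t) <= 1.
  rewrite divr_ge0 ?(ltW st0)//= ler_pdivrMr// mul1r lerDl//.
have /andP[l0 l1] := st1.
pose l := Itv01 l0 l1.
exists (s / (s + t) *: u + (1 - s / (s + t)) *: v).
  by have := Fconv u v l (mem_set Fu) (mem_set Fv); rewrite inE.
have st_neq0 : s + t != 0 by rewrite gt_eqF.
rewrite scalerDr !scalerA mulrBr mulr1 mulrCA divff// mulr1.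
by rewrite [s + t - s]addrAC subrr add0r.
Qed.

(** * Bounds on the minimal time to one target *)

Section min_time_bounds.
Variables (R : realType) (d : nat) (F Omega : set 'rV[R]_d) (r M B : R).
Hypotheses (Fconvex : convex_set F) (r0 : 0 < r) (M0 : 0 < M).
Hypothesis Fr : forall v, `|v| <= r -> F v.
Hypothesis FM : forall v, F v -> `|v| <= M.
Hypothesis Omega_neq0 : Omega !=set0.
Hypothesis OmegaB : forall w, Omega w -> `|w| <= B.
Implicit Types x y : 'rV[R]_d.

Lemma min_time_ge0 x : (0 <= min_time F x Omega)%E.
Proof. by apply/ereal_infP => _ [t [t0 _] <-]; rewrite lee_fin. Qed.

Lemma displacement_mem u : u != 0 -> F ((r / `|u|) *: u).
Proof.
move=> u0; apply: Fr; rewrite normrZ ger0_norm ?divr_ge0 ?(ltW r0)//.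
by rewrite divfK// normr_eq0.
Qed.

(** Since [F] contains the ball of radius [r], the straight motion from [x] to [w] at speed [r] is
    allowed. *)
Lemma min_time_le x w : Omega w -> (min_time F x Omega <= (`|w - x| / r)%:E)%E.
Proof.
move=> Ow; apply: ge_ereal_inf; exists (`|w - x| / r)%:E => //.
exists (`|w - x| / r) => //; split; first by rewrite divr_ge0 ?(ltW r0).
(* If [w = x] there is no direction to normalize; time 0 with velocity 0 will do. *)
have [wx|wx] := eqVneq (w - x) 0.
  exists w; split => //; exists 0; first by apply: Fr; rewrite normr0 ltW.
  by rewrite scaler0 addr0; apply/esym/eqP; rewrite -subr_eq0 wx.
exists w; split => //; exists ((r / `|w - x|) *: (w - x)).
  exact: displacement_mem.
rewrite scalerA mulrA divfK ?gt_eqF// divff ?normr_eq0//.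
by rewrite scale1r addrC subrK.
Qed.

Lemma min_time_fin_num x : min_time F x Omega \is a fin_num.
Proof.
have [w Ow] := Omega_neq0.
rewrite ge0_fin_numE ?min_time_ge0//.
exact: le_lt_trans (min_time_le x Ow) (ltry _).
Qed.

(** From [x], first go straight to [y] at speed [r], then follow a motion from [y] to the target;
    convexity merges the two. *)
Lemma min_time_lipschitz x y :
  (min_time F x Omega <= min_time F y Omega + (`|x - y| / r)%:E)%E.
Proof.
have [->|xy] := eqVneq x y.
  by rewrite subrr normr0 mul0r adde0.
rewrite -leeBlDr//; apply/ereal_infP => _ [t [t0 [_ [[v Fv <-] Oyt]]] <-].
rewrite leeBlDr// -EFinD addrC.
have yx0 : y - x != 0 by rewrite subr_eq0 eq_sym.
have s0 : 0 < `|x - y| / r by rewrite divr_gt0// normr_gt0 subr_eq0.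
have [w Fw wE] := convex_set_combination Fconvex
  (displacement_mem yx0) Fv (ltW s0) t0 (ltr_wpDr t0 s0).
apply: ge_ereal_inf; exists (`|x - y| / r + t)%:E => //.
exists (`|x - y| / r + t) => //; split; first by rewrite addr_ge0// ltW.
exists (y + t *: v); split => //; exists w => //.
rewrite wE scalerA (distrC y x) mulrA divfK ?gt_eqF// divff; last first.
  by rewrite normr_eq0 subr_eq0.
by rewrite scale1r addrA [x + _]addrC subrK.
Qed.

(** A motion of duration [t] covers at most [M * t] and has to end within [B] of the origin. *)
Lemma min_time_coercive x : (((`|x| - B) / M)%:E <= min_time F x Omega)%E.
Proof.
apply/ereal_infP => _ [t [t0 [_ [[v Fv <-] Oxt]]] <-].
rewrite lee_fin ler_pdivrMr// lerBlDl.
have -> : `|x| = `|(x + t *: v) - t *: v| by rewrite addrK.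
apply: (le_trans (ler_normB _ _)); apply: lerD; first exact: OmegaB.
by rewrite normrZ ger0_norm// ler_wpM2l// FM.
Qed.

(** The time from the origin is at most [B / r], which the coercive lower bound exceeds beyond this
    threshold. *)
Lemma min_time0_le_far x :
  B + M * (B / r) < `|x| -> (min_time F 0 Omega <= min_time F x Omega)%E.
Proof.
move=> xfar; have [w Ow] := Omega_neq0.
apply: (le_trans (min_time_le 0 Ow)); apply: le_trans (min_time_coercive x).
rewrite subr0 lee_fin ler_pdivlMr// lerBrDl.
apply: le_trans (ltW xfar); rewrite lerD2l mulrC ler_wpM2l ?(ltW M0)//.
by rewrite ler_pM2r ?invr_gt0//; exact: OmegaB.
Qed.

End min_time_bounds.

(** * The cost of several facilities and its minimizers *)

Section multifacility.
Variables (R : realType) (d m k : nat) (F : set 'rV[R]_d).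
Variable Omega : 'I_m -> set 'rV[R]_d.
Variables (r M B : R).
Hypotheses (Fconvex : convex_set F) (r0 : 0 < r) (M0 : 0 < M).
Hypothesis Fr : forall v, `|v| <= r -> F v.
Hypothesis FM : forall v, F v -> `|v| <= M.
Hypothesis Omega_neq0 : forall i, Omega i !=set0.
Hypothesis OmegaB : forall i w, Omega i w -> `|w| <= B.
Hypothesis k0 : (0 < k)%N.
Implicit Types x y : 'M[R]_(k, d).

Local Notation cost := (@multifacility_cost R d m F Omega k).

Lemma multifacility_cost_fin_num x : cost x \is a fin_num.
Proof.
apply/sum_fin_numP => i _ _; rewrite ge0_fin_numE; last first.
  by apply: le_bigmin => // j _; exact: min_time_ge0.
(* As [k] is positive, facility 0 keeps the minimum below its default [+oo]. *)
apply: (@le_lt_trans _ _ (min_time F (row (Ordinal k0) x) (Omega i))).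
  exact: bigmin_le.
by rewrite ltey_eq (min_time_fin_num r0).
Qed.

Lemma multifacility_cost_lipschitz x y :
  (cost x <= cost y + (`|x - y| / r *+ m)%:E)%E.
Proof.
have -> : (`|x - y| / r *+ m)%:E = (\sum_(i < m) (`|x - y| / r)%:E)%E.
  by rewrite sumEFin sumr_const card_ord.
rewrite -big_split; apply: lee_sum => i _ /=.
(* With the error term moved to the left, the right side is a bare minimum, to be bounded facility
   by facility. *)
rewrite -leeBlDr//; apply: le_bigmin => [|j _]; first exact: leey.
rewrite leeBlDr//; apply: (@le_trans _ _
  (min_time F (row j y) (Omega i) + (`|row j x - row j y| / r)%:E)%E).
  apply: (le_trans (bigmin_le _ j _)).
  exact: min_time_lipschitz.
by rewrite leeD2l// lee_fin ler_pM2r ?invr_gt0// -linearB row_norm_le.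
Qed.

Lemma fine_multifacility_cost_continuous : continuous (fine \o cost).
Proof.
apply: (@continuous_of_lipschitz _ _ _ _ (m%:R / r)) => x y /=.
have E z : cost z = (fine (cost z))%:E.
  by rewrite fineK// multifacility_cost_fin_num.
have := multifacility_cost_lipschitz x y.
have := multifacility_cost_lipschitz y x.
rewrite (E x) (E y) -!EFinD !lee_fin /= (distrC y x) -mulr_natr.
set a := fine _; set b := fine _ => ba ab.
by rewrite mulrAC -mulrA mulrC ler_norml; apply/andP; split; lra.
Qed.

(** Far rows jump to the origin instead of being projected onto the ball. The map need not be
    continuous: it only serves to compare costs. *)
Definition retract_far (rho : R) x : 'M[R]_(k, d) :=
  \matrix_(j < k) if `|row j x| <= rho then row j x else 0.

Lemma retract_far_norm_le (rho : R) x : 0 <= rho -> `|retract_far rho x| <= rho.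
Proof.
move=> rho0; apply: mx_norm_le => // i j; rewrite mxE.
case: ifP => [xi|_]; last by rewrite mxE normr0.
exact: le_trans (mx_entry_norm_le _ _ _) xi.
Qed.

Lemma cost_retract_far_le x :
  (cost (retract_far (B + M * (B / r)) x) <= cost x)%E.
Proof.
apply: lee_sum => i _; apply: le_bigmin2 => j _; rewrite rowK.
case: ifPn => //; rewrite -ltNge => xfar.
exact: (min_time0_le_far r0 M0 Fr FM _ (@OmegaB i)).
Qed.

(** An intersection of sublevel sets of a continuous real function is visibly closed. *)
Lemma global_minimizers_fine :
  global_minimizers cost =
  \bigcap_x [set y | (fine \o cost) y <= (fine \o cost) x].
Proof.
apply/seteqP; split => y /= yS x.
  by move=> _; rewrite /= fine_le ?multifacility_cost_fin_num.
by have := yS x I; rewrite /= -lee_fin !fineK ?multifacility_cost_fin_num.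
Qed.

Lemma closed_multifacility_minimizers : closed (global_minimizers cost).
Proof.
rewrite global_minimizers_fine; apply: closed_bigI => x _.
apply: (@preimage_closed _ _ (fine \o cost) [set z | z <= (fine \o cost) x]).
  by move=> z _; exact: fine_multifacility_cost_continuous.
exact: closed_le.
Qed.

Lemma multifacility_minimizers_neq0 : 0 <= B -> global_minimizers cost !=set0.
Proof.
move=> B0; set rho := B + M * (B / r).
have rho0 : 0 <= rho by rewrite addr_ge0// mulr_ge0 ?divr_ge0 ?(ltW r0) ?(ltW M0).
pose K := [set x : 'M[R]_(k, d) | `|x| <= rho].
have K_neq0 : K !=set0 by exists 0; rewrite /K /= normr0.
have cost_cont : {within K, continuous (fine \o cost)}.
  exact/continuous_subspaceT/fine_multifacility_cost_continuous.
have [y _ ymin] := compact_EVT_min K_neq0 (@mx_ball_compact R k d rho) cost_cont.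
(* The retraction of [x] lies in [K], where [y] is optimal. *)
exists y => x; apply: le_trans (cost_retract_far_le x).
rewrite -[leLHS]fineK ?multifacility_cost_fin_num//.
rewrite -[leRHS]fineK ?multifacility_cost_fin_num// lee_fin.
by apply: ymin; rewrite inE; exact: retract_far_norm_le.
Qed.

End multifacility.

(** * The constants [M], [r] and [B] from the hypotheses *)

Lemma compact_norm_le (R : realType) (V : normedModType R) (A : set V) :
  compact A -> exists2 M : R, 0 < M & forall v, A v -> `|v| <= M.
Proof.
move=> /compact_bounded[M0 [_ AM]]; exists (`|M0| + 1); first by rewrite ltr_pwDr.
by apply: AM; rewrite (le_lt_trans (ler_norm M0))// ltrDl.
Qed.

Unset Implicit Arguments.

Theorem theorem4p1 (R : realType) (d : nat) (hd : (1 <= d)%N)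
    (F : set 'rV[R]_d) (Fcompact : compact F) (Fconvex : convex_set F)
    (F0 : interior F 0)
    (m : nat) (hm : (2 <= m)%N) (k : nat) (hk : (1 <= k <= m)%N)
    (Omega : 'I_m -> set 'rV[R]_d)
    (Omega_neq0 : forall i, Omega i !=set0)
    (Omega_compact : forall i, compact (Omega i)) :
  let S := global_minimizers (@multifacility_cost R d m F Omega k) in
  S !=set0 /\ closed S.
Proof.
have /andP[k0 _] := hk.
have [M M0 FM] := compact_norm_le Fcompact.
have [e /= e0 Fe] : nbhs_ball 0 F by exact/nbhs_ballP.
(* The ball of radius [e] is open; half the radius gives a closed ball inside [F]. *)
have r0 : 0 < e / 2 by rewrite divr_gt0.
have Fr v : `|v| <= e / 2 -> F v.
  move=> ve; apply: Fe; rewrite -ball_normE /= sub0r normrN.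
  by rewrite (le_lt_trans ve)// ltr_pdivrMr// ltr_pMr// ltr1n.
have /choice[b bP] i : exists b : R, forall w, Omega i w -> `|w| <= b.
  by have [b _ ?] := compact_norm_le (Omega_compact i); exists b.
(* One bound for all targets; the default 0 makes it nonnegative. *)
pose B := \big[Num.max/0]_i b i.
have B0 : 0 <= B by exact: bigmax_ge_id.
have OmegaB i w : Omega i w -> `|w| <= B.
  by move=> /bP wb; apply: le_trans wb _; exact: le_bigmax.
split.
- exact: (multifacility_minimizers_neq0 Fconvex r0 M0 Fr FM Omega_neq0 OmegaB k0 B0).
- exact: (closed_multifacility_minimizers Fconvex r0 Fr Omega_neq0 k0).
Qed.
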